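(* An idempotent, $k$-translatable groupoid $Q$ of order $n$ is right distributive if and only if it is left distributive.
   Context: A groupoid is a set with a binary operation $\cdot$. It is idempotent if $x\cdot x=x$ for all $x$; right distributive if $(x\cdot y)\cdot z=(x\cdot z)\cdot(y\cdot z)$ for all $x,y,z$; left distributive if $x\cdot(y\cdot z)=(x\cdot y)\cdot(x\cdot z)$ for all $x,y,z$. For an integer $x$, $[x]_n$ denotes the residue of $x$ modulo $n$, represented in $\{1,\ldots,n\}$, with $0$ identified with $n$. All groupoids are finite and taken to be of the form $Q=\{1,\ldots,n\}$ with the natural ordering. For $1\le k<n$, $Q$ is $k$-translatable if in its multiplication table each row $i$, $2\le i\le n$, is obtained from row $i-1$ by cyclically shifting it $k$ places to the right, i.e. $i\cdot j=(i-1)\cdot[j-k]_n$ for all $j$ and all $2\le i\le n$. *)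

(* Defs.v *)
From mathcomp Require Import all_boot all_order all_algebra.

Set Implicit Arguments.
Unset Strict Implicit.
Unset Printing Implicit Defensive.

Import Order.TTheory GRing.Theory Num.Theory.

Local Open Scope ring_scope.

Definition carrier (n : nat) : Type := {i : nat | (0 < i <= n)%N}.

(* [x]_n as a number: the representative in {1, ..., n}, with 0 replaced by n. *)
Definition residue (n : nat) (x : int) : nat :=
  if (x %% n%:Z)%Z == 0 then n else `|(x %% n%:Z)%Z|%N.

Lemma residueP (n : nat) (x : int) : (0 < n)%N -> (0 < residue n x <= n)%N.
Proof.
move=> n_gt0; have nz : n%:Z != 0 by rewrite eqz_nat -lt0n.
rewrite /residue; case: eqP => [_|/eqP r0]; first by rewrite n_gt0 leqnn.
rewrite absz_gt0 r0 /= -lez_nat gez0_abs ?modz_ge0 //.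
by apply: ltW; rewrite ltz_pmod.
Qed.

Lemma carrier_gt0 (n : nat) (j : carrier n) : (0 < n)%N.
Proof. by case: j => j /= /andP[j_gt0]; apply: leq_trans. Qed.

(* [j - k]_n as an element of {1, ..., n}; n > 0 because j exists. *)
Definition shift (n k : nat) (j : carrier n) : carrier n :=
  exist _ (residue n ((val j)%:Z - k%:Z))
    (residueP ((val j)%:Z - k%:Z) (carrier_gt0 j)).

(* Rows i and i' range over all consecutive pairs 2 <= i <= n, i' = i - 1;
   row 1 is not required to be a shift of row n. *)
Definition translatable (n k : nat) (op : carrier n -> carrier n -> carrier n) :
    Prop :=
  forall i i' j : carrier n,
    val i = (val i').+1 -> op i j = op i' (shift k j).

(* Right distributivity (x . y) . z = (x . z) . (y . z) is ssrfun's
   left_distributive, which is named after the side on which the compound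
   argument stands; hence the exchange of left and right. *)
Definition right_selfdistributive (T : Type) (op : T -> T -> T) : Prop :=
  left_distributive op op.

Definition left_selfdistributive (T : Type) (op : T -> T -> T) : Prop :=
  right_distributive op op.

(* Main.v *)
Require Import Defs.
From mathcomp Require Import all_boot all_order all_algebra.
From mathcomp Require Import ring.

(** Both distributive laws hold in every idempotent k-translatable groupoid, so
    they are equivalent.  Read the elements as residues modulo n.
    Translatability makes x . y a function f of y - k x alone
    ([translatable_factors]).  Idempotence then says f ((1 - k) x) = x, so f is
    a left inverse of multiplication by 1 - k, hence a two-sided one because
    the residue ring is finite.  Thus (1 - k) (x . y) = y - k x
    ([idempotent_translatable_affine]): the operation is an affine combination
    of its arguments.  Multiplied by the cancellable factor (1 - k)^2, each
    distributive law becomes a polynomial identity. *)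

Set Implicit Arguments.
Unset Strict Implicit.
Unset Printing Implicit Defensive.

Import GRing.Theory.

Local Open Scope ring_scope.

Section ResidueClass.

Variables (n : nat) (n_gt1 : (1 < n)%N).

Definition to_Zp (x : carrier n) : 'Z_n := (val x)%:R.

Definition of_Zp (t : 'Z_n) : carrier n :=
  exist _ (residue n (val t)%:Z) (residueP (val t)%:Z (ltnW n_gt1)).

Lemma natr_residue (x : int) : (residue n x)%:R = x%:~R :> 'Z_n.
Proof.
have n0 : n%:R = 0 :> 'Z_n by rewrite -Zp_nat_mod // modnn.
have n_nz : n%:Z != 0 by rewrite eqz_nat -lt0n ltnW.
rewrite [in RHS](divz_eq x n%:Z) intrD intrM -[n%:~R]/(n%:R) n0 mulr0 add0r.
rewrite /residue; case: eqP => [->|_] //.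
by rewrite -[in RHS](gez0_abs (modz_ge0 x n_nz)).
Qed.

Lemma of_ZpK : cancel of_Zp to_Zp.
Proof. by move=> t; rewrite /to_Zp natr_residue -[LHS]/((val t)%:R) natr_Zp. Qed.

Lemma to_Zp_inj : injective to_Zp.
Proof.
move=> x y /(congr1 val); rewrite /= !val_Zp_nat // => xy.
apply: val_inj; case: x y xy => [x /= /andP[x0 xn]] [y /= /andP[y0 yn]].
move: xn yn; rewrite (leq_eqVlt x) (leq_eqVlt y).
case/predU1P=> [->|x_lt] /predU1P[->|y_lt] //.
- by rewrite modnn modn_small // => y_eq0; rewrite -y_eq0 in y0.
- by rewrite modnn modn_small // => x_eq0; rewrite x_eq0 in x0.
- by rewrite !modn_small.
Qed.

Lemma to_Zp_shift k (j : carrier n) : to_Zp (shift k j) = to_Zp j - k%:R.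
Proof. by rewrite /to_Zp natr_residue intrB. Qed.

(** Descending from row i to row 1 takes i - 1 shifts by k.  The resulting
    column y - k x + k depends only on the residue of x, so the wrap-around from
    row n to row 1 respects the shift as well. *)
Lemma translatable_factors k (op : carrier n -> carrier n -> carrier n) :
  translatable k op ->
  exists f : 'Z_n -> carrier n,
    forall x y, op x y = f (to_Zp y - k%:R * to_Zp x).
Proof.
move=> op_transl; pose one : carrier n := exist _ 1%N (ltnW n_gt1).
exists (fun t => op one (of_Zp (t + k%:R))) => -[i i_range].
elim: i i_range => [//|[_|i IHi]] i_range y.
  have -> : exist _ 1%N i_range = one by apply: val_inj.
  congr (op one _); apply: to_Zp_inj.
  by rewrite of_ZpK /to_Zp /=; ring.
have i'_range : (0 < i.+1 <= n)%N by apply: ltnW.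
rewrite (op_transl _ (exist _ i.+1 i'_range)) // IHi to_Zp_shift.
by congr (op one (of_Zp _)); rewrite /to_Zp /= [i.+2%:R]mulrSr; ring.
Qed.

Lemma idempotent_translatable_affine k
    (op : carrier n -> carrier n -> carrier n) :
  idempotent_op op -> translatable k op ->
  injective (fun t : 'Z_n => (1 - k%:R) * t) /\
  forall x y, (1 - k%:R) * to_Zp (op x y) = to_Zp y - k%:R * to_Zp x.
Proof.
move=> op_idem /translatable_factors[f opE].
have mulK : cancel (fun t : 'Z_n => (1 - k%:R) * t) (to_Zp \o f).
  move=> t; rewrite -{2}[t]of_ZpK -[in RHS](op_idem (of_Zp t)) opE of_ZpK /=.
  by rewrite mulrBl mul1r.
split=> [|x y]; first exact: can_inj mulK.
by rewrite opE; exact: (canF_sym mulK).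
Qed.

End ResidueClass.

(** An operation that is affine after scaling by a cancellable u = 1 - k is
    distributive on both sides.  Both sides of each law become equal when scaled
    by u^2, one factor for each of the two nested operations. *)
Lemma affine_selfdistributive (R : comPzRingType) (T : Type) (phi : T -> R)
    (k : R) (op : T -> T -> T) :
  injective phi -> injective (fun t => (1 - k) * t) ->
  (forall x y, (1 - k) * phi (op x y) = phi y - k * phi x) ->
  right_selfdistributive op /\ left_selfdistributive op.
Proof.
move=> phi_inj mul_inj opE.
have op2E x y z w : (1 - k) * ((1 - k) * phi (op (op x y) (op z w))) =
    (phi w - k * phi z) - k * (phi y - k * phi x).
  by rewrite opE mulrBr mulrCA !opE.
split=> x y z; apply/phi_inj/mul_inj/mul_inj; rewrite op2E opE mulrBr mulrCA opE;
  ring.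
Qed.

Theorem proposition2p13 (n k : nat) (hk : (0 < k < n)%N)
    (op : carrier n -> carrier n -> carrier n)
    (op_idem : idempotent_op op) (op_transl : translatable k op) :
  right_selfdistributive op <-> left_selfdistributive op.
Proof.
have n_gt1 : (1 < n)%N by case/andP: hk; apply: leq_ltn_trans.
have [mul_inj opE] := idempotent_translatable_affine n_gt1 op_idem op_transl.
by have [] := affine_selfdistributive (to_Zp_inj n_gt1) mul_inj opE.
Qed.
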